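(* Let $A \subseteq B$ be an inclusion of C*-algebras with a faithful conditional expectation $E : B \to A$ (onto $A$). Suppose that $E$ has the pinching property. Then $A \subseteq B$ is an SP-inclusion if and only if $B$ has Property (SP).
   Context: C*-algebras are not assumed unital. A C*-algebra has Property (SP) if each of its nonzero hereditary C*-subalgebras contains a nonzero projection. An inclusion of C*-algebras $A \subseteq B$ is called an SP-inclusion if for every nonzero element $a \in A_+$ the hereditary C*-subalgebra $\overline{aBa}$ of $B$ contains a nonzero projection. A conditional expectation $E: B \to A$ has the pinching property if for every nonzero $x \in B_+$ and every $\varepsilon > 0$ there is an element $y \in A$ such that $$\|y^*(x - E(x))y\| < \varepsilon \quad\text{and}\quad \|y^*E(x)y\| \geq \|E(x)\| - \varepsilon.$$ *)

(* Defs.v *)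
(* MathComp-Analysis; the scalars are the complex numbers R[i] over R : realType. *)
From HB Require Import structures.
From mathcomp Require Export all_boot all_order all_algebra.
From mathcomp Require Export all_classical all_reals all_analysis.
From mathcomp Require Export complex.

Set Implicit Arguments.
Unset Strict Implicit.
Unset Printing Implicit Defensive.

Import Order.TTheory GRing.Theory Num.Theory.
Import numFieldNormedType.Exports.

Declare Scope cstar_scope.
Delimit Scope cstar_scope with cstar.

Local Open Scope classical_set_scope.
Local Open Scope complex_scope.
Local Open Scope ring_scope.

(* Not necessarily unital: MathComp rings have a unit, so the product is a
   separate operation.  The norm of a normed module over R[i] takes (nonnegative
   real) values in R[i]. *)
HB.mixin Record CompleteNormedModule_isCStarAlgebra (R : realType) B
    & CompleteNormedModule R[i] B := {
  cmul : B -> B -> B;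
  cstar : B -> B;
  cmulA : forall x y z, cmul x (cmul y z) = cmul (cmul x y) z;
  cmulDl : forall x y z, cmul (x + y) z = cmul x z + cmul y z;
  cmulDr : forall x y z, cmul x (y + z) = cmul x y + cmul x z;
  cmulZl : forall (a : R[i]) x y, cmul (a *: x) y = a *: cmul x y;
  cmulZr : forall (a : R[i]) x y, cmul x (a *: y) = a *: cmul x y;
  cnormM : forall x y, `|cmul x y| <= `|x| * `|y|;
  cstarK : forall x, cstar (cstar x) = x;
  cstarD : forall x y, cstar (x + y) = cstar x + cstar y;
  cstarZ : forall (a : R[i]) x, cstar (a *: x) = conjc a *: cstar x;
  cstarM : forall x y, cstar (cmul x y) = cmul (cstar y) (cstar x);
  cstar_norm : forall x, `|cmul (cstar x) x| = `|x| ^+ 2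
}.

#[short(type="cstarAlgType")]
HB.structure Definition CStarAlgebra (R : realType) :=
  {B of CompleteNormedModule_isCStarAlgebra R B & CompleteNormedModule R[i] B}.

Notation "x ** y" := (cmul x y) (at level 40, left associativity) : cstar_scope.
Notation "x ^*" := (cstar x) : cstar_scope.

Local Open Scope cstar_scope.

Definition cstar_subalgebra (R : realType) (B : cstarAlgType R) (A : set B) :
    Prop :=
  [/\ A 0,
      (forall x y, A x -> A y -> A (x + y)),
      (forall (a : R[i]) x, A x -> A (a *: x)),
      (forall x y, A x -> A y -> A (x ** y)) &
      (forall x, A x -> A x^*) /\ closed A].

(* A_+ = {z^* z : z in A} for a C*-subalgebra A; B_+ is pos_cone setT. *)
Definition pos_cone (R : realType) (B : cstarAlgType R) (A : set B) : set B :=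
  [set x | exists2 z, A z & x = z^* ** z].

Definition is_projection (R : realType) (B : cstarAlgType R) (p : B) : Prop :=
  p ** p = p /\ p^* = p.

Definition has_nonzero_projection (R : realType) (B : cstarAlgType R)
    (H : set B) : Prop :=
  exists p, [/\ H p, is_projection p & p <> 0].

(* [pos_cone setT (h - b)] is the order relation b <= h of B. *)
Definition hereditary_subalgebra (R : realType) (B : cstarAlgType R)
    (H : set B) : Prop :=
  cstar_subalgebra H /\
  (forall b h, pos_cone setT b -> pos_cone H h -> pos_cone setT (h - b) -> H b).

Definition property_SP (R : realType) (B : cstarAlgType R) : Prop :=
  forall H : set B, hereditary_subalgebra H -> (exists2 x, H x & x <> 0) ->
    has_nonzero_projection H.

Definition SP_inclusion (R : realType) (B : cstarAlgType R) (A : set B) : Prop :=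
  forall a, pos_cone A a -> a <> 0 ->
    has_nonzero_projection (closure [set a ** b ** a | b in [set: B]]).

(* A positive contractive linear projection of B onto A which is A-bimodular.
   E is regarded as a map B -> B with range A.  Complete positivity follows from
   positivity and bimodularity. *)
Definition conditional_expectation (R : realType) (B : cstarAlgType R)
    (A : set B) (E : {linear B -> B}) : Prop :=
  [/\ (forall x, A (E x)) /\ (forall a, A a -> E a = a),
      (forall x, `|E x| <= `|x|),
      (forall x, pos_cone setT x -> pos_cone A (E x)) &
      (forall a x, A a -> E (a ** x) = a ** E x /\ E (x ** a) = E x ** a)].

Definition faithful (R : realType) (B : cstarAlgType R) (E : B -> B) : Prop :=
  forall x, pos_cone setT x -> E x = 0 -> x = 0.

Definition pinching (R : realType) (B : cstarAlgType R) (A : set B)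
    (E : B -> B) : Prop :=
  forall x, pos_cone setT x -> x <> 0 -> forall e : R, 0 < e ->
    exists y, [/\ A y,
      `|y^* ** (x - E x) ** y| < e%:C &
      `|y^* ** E x ** y| >= `|E x| - e%:C].

(* Main.v *)
Require Import Defs.
From mathcomp Require Import all_boot all_order all_algebra.
From mathcomp Require Import all_classical all_reals all_analysis.
From mathcomp Require Import ring lra.

(** The property (SP) passes from the inclusion to [B] by comparing projections.
    Let [H] be hereditary, [k] a nonzero element of [H] and [x = k^* ** k].
    Faithfulness gives [E x <> 0], and pinching gives [y] in [A] such that
    [y^* ** x ** y] is close to [y^* ** E x ** y = m^* ** m], with [m] in [A],
    in comparison with the norm of the latter.  Conjugating by [m] turns
    [m^* ** m] into the square of the self-adjoint element [m ** m^*] of [A].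
    Let [u] be this element, normalised to have norm 1.  The element
    [a = 4 (u^2 - 1/2)_+] of [A] is nonzero, and a projection [p] in the closure
    of [a^2 B a^2] lives where [u^2] is at least 1/2, so that
    [p - p u^2 p] has norm at most 1/2 ([spectral_cut]).  Up to a small error
    [p u^2 p] is [v^* ** v] for [v = k y m^* p / |m|^2]; hence [v^* ** v] is
    invertible in [p B p], and if [g] is its inverse then [v g v^*] is a nonzero
    projection ([polar_projection]).  It has the form [k b k^*] and is dominated
    by a multiple of [k ** k^*], so it belongs to [H] ([hereditary_sandwich]).

    Conversely, the closure of [a B a] is a hereditary subalgebra of [B] when
    [a] is self-adjoint ([corner_hereditary]), and it contains [a^3].  The content
    is that [z^* z <= k^* k] makes [z (1 - f)] small as soon as [k (1 - f)] is
    small, where [f = a^2 / (e + a^2)] is an approximate unit for [a].  This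
    rests on [norm_le_add]: the norm of [x^* x] is bounded by a constant times
    that of [x^* x + y^* y].

    Neither direction uses spectra or states.  An element [g - a] of the
    unitization, with [g] a scalar and [a] in [B], is represented by the map
    [z |-> g z - a z], and its norm by a bound on this map.  Two constructions
    replace the continuous functional calculus: square roots, as limits of an
    iteration whose increments are majorised by those of a numerical
    sequence ([exists_sqrt]), and resolvents, as sums of geometric series
    ([resolvent]).  Norm estimates come from the unitary
    [u + i (1 - u^2)^(1/2)] attached to a self-adjoint contraction [u]: the
    real and imaginary parts [2 u^2 - 1] and [2 u (1 - u^2)^(1/2)] of its
    square are contractions ([double_angle]). *)

Set Implicit Arguments.
Unset Strict Implicit.
Unset Printing Implicit Defensive.

Import Order.TTheory GRing.Theory Num.Theory.
Import numFieldNormedType.Exports.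
Local Open Scope classical_set_scope.
Local Open Scope complex_scope.
Local Open Scope ring_scope.
Local Open Scope cstar_scope.
Local Notation "x ^*" := (cstar x) : ring_scope.

(** * Elementary identities *)

Section Basics.
Context {R : realType} {B : cstarAlgType R}.
Implicit Types x y z : B.

Lemma cmul0l x : 0 ** x = 0.
Proof. by rewrite -(scale0r (0 : B)) cmulZl !scale0r. Qed.
Lemma cmul0r x : x ** 0 = 0.
Proof. by rewrite -(scale0r (0 : B)) cmulZr !scale0r. Qed.
Lemma cmulNl x y : (- x) ** y = - (x ** y).
Proof. by rewrite -scaleN1r cmulZl scaleN1r. Qed.
Lemma cmulNr x y : x ** (- y) = - (x ** y).
Proof. by rewrite -scaleN1r cmulZr scaleN1r. Qed.
Lemma cstarZR (k : R) x : (k%:C *: x)^* = k%:C *: x^*.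
Proof. by rewrite cstarZ conjc_real. Qed.
Lemma cstarN x : (- x)^* = - x^*.
Proof.
have E : (-1 : R[i]) = (-1)%:C by rewrite rmorphN1.
by rewrite -scaleN1r E cstarZR -E scaleN1r.
Qed.
Lemma cstar0 : (0 : B)^* = 0.
Proof. by rewrite -(scale0r (0 : B)) cstarZ conjc0 !scale0r. Qed.
Lemma cstarB x y : (x - y)^* = x^* - y^*.
Proof. by rewrite cstarD cstarN. Qed.
End Basics.

(** * Deciding noncommutative polynomial identities *)

Section NcTerm.
Variables (R : realType) (B : cstarAlgType R).

(** [B] is not a ring in the sense of the algebraic hierarchy, having no unit,
    and its product is not commutative, so an identity between polynomial
    expressions in elements of [B] is decided by reflection: both sides are
    expanded into linear combinations of words, and the difference of the
    coefficients of each word is left to the scalar tactics. *)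
Inductive ncterm :=
  | NVar of nat
  | NZero
  | NAdd of ncterm & ncterm
  | NOpp of ncterm
  | NScale of R[i] & ncterm
  | NMul of ncterm & ncterm.

(** The first letter is kept apart because the empty product does not exist in
    [B]. *)
Definition ncword := (nat * list nat)%type.
Definition ncpoly := list (R[i] * ncword)%type.

Fixpoint nceval (e : seq B) t : B :=
  match t with
  | NVar n => nth 0 e n
  | NZero => 0
  | NAdd a b => nceval e a + nceval e b
  | NOpp a => - nceval e a
  | NScale k a => k *: nceval e a
  | NMul a b => nceval e a ** nceval e b
  end.

Fixpoint ncwtail (e : seq B) (x : B) (l : list nat) : B :=
  match l with [::] => x | n :: l' => ncwtail e (x ** nth 0 e n) l' end.

Definition ncweval e (w : ncword) := ncwtail e (nth 0 e w.1) w.2.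

Fixpoint ncpeval e (p : ncpoly) : B :=
  match p with [::] => 0 | m :: p' => m.1 *: ncweval e m.2 + ncpeval e p' end.

(** The comparison and concatenation of words are written with plain fixpoints
    so that they can be reduced without unfolding the coefficients. *)
Fixpoint natlist_eq (l m : list nat) : bool :=
  match l, m with
  | [::], [::] => true
  | a :: l', b :: m' => if eqn a b then natlist_eq l' m' else false
  | _, _ => false
  end.

Definition ncword_eq (v w : ncword) : bool :=
  if eqn v.1 w.1 then natlist_eq v.2 w.2 else false.

Fixpoint nclapp (l m : list nat) :=
  match l with [::] => m | a :: l' => a :: nclapp l' m end.

Definition ncwcat (v w : ncword) : ncword := (v.1, nclapp v.2 (w.1 :: w.2)).

Fixpoint ncins (k : R[i]) (w : ncword) (p : ncpoly) : ncpoly :=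
  match p with
  | [::] => [:: (k, w)]
  | m :: p' => if ncword_eq m.2 w then (m.1 + k, m.2) :: p'
               else m :: ncins k w p'
  end.

Fixpoint ncadd (p q : ncpoly) : ncpoly :=
  match p with [::] => q | m :: p' => ncins m.1 m.2 (ncadd p' q) end.

Fixpoint ncscale (k : R[i]) (p : ncpoly) : ncpoly :=
  match p with [::] => [::] | m :: p' => (k * m.1, m.2) :: ncscale k p' end.

Fixpoint ncmul1 (k : R[i]) (w : ncword) (p : ncpoly) : ncpoly :=
  match p with
  | [::] => [::] | m :: p' => (k * m.1, ncwcat w m.2) :: ncmul1 k w p' end.

Fixpoint ncmul (p q : ncpoly) : ncpoly :=
  match p with [::] => [::] | m :: p' => ncadd (ncmul1 m.1 m.2 q) (ncmul p' q)
  end.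

Fixpoint ncnorm (t : ncterm) : ncpoly :=
  match t with
  | NVar n => [:: (1, (n, [::]))]
  | NZero => [::]
  | NAdd a b => ncadd (ncnorm a) (ncnorm b)
  | NOpp a => ncscale (-1) (ncnorm a)
  | NScale k a => ncscale k (ncnorm a)
  | NMul a b => ncmul (ncnorm a) (ncnorm b)
  end.

Fixpoint nczero (p : ncpoly) : Prop :=
  match p with [::] => True | m :: p' => m.1 = 0 /\ nczero p' end.

Lemma natlist_eqP l m : natlist_eq l m -> l = m.
Proof.
elim: l m => [|a l IH] [|b m] //=.
by case E: (eqn a b) => // /IH ->; move/eqnP: E => ->.
Qed.

Lemma ncword_eqP v w : ncword_eq v w -> v = w.
Proof.
case: v w => [a l] [b m]; rewrite /ncword_eq /=.
by case E: (eqn a b) => // /natlist_eqP ->; move/eqnP: E => ->.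
Qed.

Lemma ncwtail_mul e x y l : ncwtail e (x ** y) l = x ** ncwtail e y l.
Proof. by elim: l y => [|n l IH] y //=; rewrite -cmulA IH. Qed.

Lemma ncweval_cat e v w : ncweval e (ncwcat v w) = ncweval e v ** ncweval e w.
Proof.
case: v w => [a l] [b m]; rewrite /ncweval /=.
by elim: l (nth 0 e a) => [|c l IH] x //=; rewrite ?ncwtail_mul // IH.
Qed.

Lemma ncins_eval e k w p :
  ncpeval e (ncins k w p) = k *: ncweval e w + ncpeval e p.
Proof.
elim: p => [|m p IH] //=.
case E: (ncword_eq m.2 w) => /=; last by rewrite IH addrCA.
by rewrite (ncword_eqP E) scalerDl addrA (addrC (m.1 *: _)).
Qed.

Lemma ncadd_eval e p q : ncpeval e (ncadd p q) = ncpeval e p + ncpeval e q.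
Proof.
by elim: p => [|m p IH] /=; rewrite ?add0r // ncins_eval IH addrA.
Qed.

Lemma ncscale_eval e k p : ncpeval e (ncscale k p) = k *: ncpeval e p.
Proof.
by elim: p => [|m p IH] /=; rewrite ?scaler0 // IH scalerDr scalerA.
Qed.

Lemma ncmul1_eval e k w p :
  ncpeval e (ncmul1 k w p) = (k *: ncweval e w) ** ncpeval e p.
Proof.
elim: p => [|m p IH] /=; first by rewrite cmul0r.
by rewrite IH cmulDr ncweval_cat cmulZr !cmulZl scalerA mulrC.
Qed.

Lemma ncmul_eval e p q : ncpeval e (ncmul p q) = ncpeval e p ** ncpeval e q.
Proof.
elim: p => [|m p IH] /=; first by rewrite cmul0l.
by rewrite ncadd_eval ncmul1_eval IH cmulDl.
Qed.

Lemma ncnorm_eval e t : ncpeval e (ncnorm t) = nceval e t.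
Proof.
elim: t => [n||a IHa b IHb|a IHa|k a IHa|a IHa b IHb] //=.
- by rewrite scale1r addr0.
- by rewrite ncadd_eval IHa IHb.
- by rewrite ncscale_eval IHa scaleN1r.
- by rewrite ncscale_eval IHa.
- by rewrite ncmul_eval IHa IHb.
Qed.

Lemma nczero_eval e p : nczero p -> ncpeval e p = 0.
Proof. by elim: p => [|m p IH] //= [-> /IH ->]; rewrite scale0r addr0. Qed.

Lemma nc_correct e s t :
  nczero (ncnorm (NAdd s (NOpp t))) -> nceval e s = nceval e t.
Proof.
move=> /(nczero_eval e); rewrite ncnorm_eval /= => /eqP.
by rewrite subr_eq0 => /eqP.
Qed.
End NcTerm.

Ltac nc_mem x l :=
  match l with
  | nil => constr:(false)
  | x :: _ => constr:(true)
  | _ :: ?l' => nc_mem x l'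
  end.
Ltac nc_idx x l :=
  match l with
  | x :: _ => constr:(0%N)
  | _ :: ?l' => let n := nc_idx x l' in constr:(S n)
  end.
Ltac nc_atoms t l :=
  match t with
  | 0 => l
  | ?a + ?b => let l1 := nc_atoms a l in nc_atoms b l1
  | - ?a => nc_atoms a l
  | _ *: ?a => nc_atoms a l
  | ?a ** ?b => let l1 := nc_atoms a l in nc_atoms b l1
  | ?x => match nc_mem x l with true => l | false => constr:(x :: l) end
  end.
Ltac nc_reify R t l :=
  match t with
  | 0 => constr:(@NZero R)
  | ?a + ?b => let s := nc_reify R a l in let u := nc_reify R b l in
               constr:(NAdd s u)
  | - ?a => let s := nc_reify R a l in constr:(NOpp s)
  | ?k *: ?a => let s := nc_reify R a l in constr:(@NScale R k s)
  | ?a ** ?b => let s := nc_reify R a l in let u := nc_reify R b l in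
               constr:(NMul s u)
  | ?x => let n := nc_idx x l in constr:(@NVar R n)
  end.
Ltac ncstep :=
  match goal with
  | |- @eq ?T ?x ?y =>
    match goal with B : cstarAlgType ?R |- _ =>
    let l0 := nc_atoms x (@nil B) in
    let l := nc_atoms y l0 in
    let s := nc_reify R x l in
    let t := nc_reify R y l in
    refine (@nc_correct R B l s t _);
    cbv [ncnorm ncadd ncscale ncmul ncmul1 ncins ncwcat nclapp ncword_eq
         natlist_eq eqn nczero fst snd]
    end
  end.
(** [ncring: H] uses the equation [H] between scalars.  The adjoint is an
    operation on atoms only; it has to be distributed beforehand. *)
Tactic Notation "ncring" := ncstep; repeat split; ring.
Tactic Notation "ncring" ":" constr(H) := ncstep; repeat split; ring: H.
Tactic Notation "ncfield" := ncstep; repeat split; field; try done.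

(** * The norm as a real number *)

Section RNorm.
Context {R : realType} {B : cstarAlgType R}.
Implicit Types x y z : B.

(** The norm of [B] takes its values in the nonnegative reals of [R[i]], where
    the order is only partial; estimates are made in [R]. *)
Definition rnorm x : R := complex.Re `|x|.

Lemma rnormE x : `|x| = (rnorm x)%:C.
Proof. by rewrite /rnorm RRe_real // ger0_real. Qed.

Lemma rnorm_ge0 x : 0 <= rnorm x.
Proof. by rewrite -ler0c -rnormE. Qed.

Lemma rnorm0 : rnorm 0 = 0.
Proof. by apply: complexI; rewrite -rnormE normr0. Qed.

Lemma rnorm0_eq0 x : rnorm x = 0 -> x = 0.
Proof. by move=> x0; apply/eqP; rewrite -normr_eq0 rnormE x0. Qed.

Lemma rnorm_gt0 x : x <> 0 -> 0 < rnorm x.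
Proof.
move=> x0; rewrite lt_def rnorm_ge0 andbT; apply/eqP => /rnorm0_eq0; exact: x0.
Qed.

Lemma rnormN x : rnorm (- x) = rnorm x.
Proof. by rewrite /rnorm normrN. Qed.

Lemma rnormD x y : rnorm (x + y) <= rnorm x + rnorm y.
Proof. by rewrite -lecR rmorphD /= -!rnormE ler_normD. Qed.

Lemma rnormB x y : rnorm (x - y) <= rnorm x + rnorm y.
Proof. by rewrite (le_trans (rnormD _ _)) // rnormN. Qed.

Lemma rnorm_distC x y : rnorm (x - y) = rnorm (y - x).
Proof. by rewrite -rnormN opprB. Qed.

Lemma rnormZ (k : R) x : rnorm (k%:C *: x) = `|k| * rnorm x.
Proof.
by apply: complexI; rewrite rmorphM /= -!rnormE normrZ normc_def /= expr0n addr0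
  sqrtr_sqr.
Qed.

Lemma rnorm_imag (j : R[i]) x : j * j = -1 -> rnorm (j *: x) = rnorm x.
Proof.
move=> jj; have : `|j| ^+ 2 = 1 by rewrite -normrX expr2 jj normrN1.
move=> /eqP; rewrite sqrp_eq1 // => /eqP j1.
by rewrite /rnorm normrZ j1 mul1r.
Qed.

Lemma rnormM x y : rnorm (x ** y) <= rnorm x * rnorm y.
Proof. by rewrite -lecR rmorphM /= -!rnormE cnormM. Qed.

Lemma rnorm_cstarM x : rnorm (x^* ** x) = rnorm x ^+ 2.
Proof. by apply: complexI; rewrite rmorphXn /= -!rnormE cstar_norm. Qed.

(** The C*-identity gives [|y|^2 <= |y^*| |y|], hence [|y| <= |y^*|]. *)
Lemma rnorm_cstar x : rnorm x^* = rnorm x.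
Proof.
suff le y : rnorm y <= rnorm y^*.
  by apply/eqP; rewrite eq_le le andbT -{2}(cstarK x) le.
have [->|/eqP y0] := eqVneq y 0; first by rewrite rnorm0 rnorm_ge0.
have := rnormM y^* y; rewrite rnorm_cstarM expr2 ler_pM2r //.
exact: rnorm_gt0.
Qed.

Lemma rnorm_mulCstar x : rnorm (x ** x^*) = rnorm x ^+ 2.
Proof. by rewrite -{1}(cstarK x) rnorm_cstarM rnorm_cstar. Qed.

Lemma rnorm_sqr x : x^* = x -> rnorm (x ** x) = rnorm x ^+ 2.
Proof. by move=> xs; rewrite -{1}xs rnorm_cstarM. Qed.

Lemma rnorm_le_sqr x (k : R) : 0 <= k ->
  rnorm x ^+ 2 <= k * rnorm x -> rnorm x <= k.
Proof.
move=> k0; have [-> //|/eqP x0] := eqVneq x 0; first by rewrite rnorm0.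
by rewrite expr2 ler_pM2r // rnorm_gt0.
Qed.

(** Left multiplication is isometric from [B] to its bounded operators: test
    it on [w^*]. *)
Lemma rnorm_le_mul (w : B) (k : R) : 0 <= k ->
  (forall z, rnorm (w ** z) <= k * rnorm z) -> rnorm w <= k.
Proof.
move=> k0 /(_ w^*); rewrite rnorm_mulCstar rnorm_cstar.
exact: rnorm_le_sqr.
Qed.
End RNorm.

(** * Limits of sequences *)

Section Limits.
Context {R : realType} {B : cstarAlgType R}.
Implicit Types (x y z : B) (u v : nat -> B).

Lemma rcvgP u x : (u @ \oo --> x) <->
  (forall e : R, 0 < e -> \forall n \near \oo, rnorm (x - u n) < e).
Proof.
split=> [/cvgrPdist_lt H e e0|H].
  have := H e%:C; rewrite ltcR => /(_ e0); apply: filterS => n.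
  by rewrite rnormE ltcR.
apply/cvgrPdist_lt => e e0.
have [k ek] : exists k, e = k%:C.
  by exists (complex.Re e); rewrite RRe_real // gtr0_real.
move: e0; rewrite ek ltcR => /H; apply: filterS => n.
by rewrite rnormE ltcR.
Qed.

Lemma rcvg_uniq u x y : u @ \oo --> x -> u @ \oo --> y -> x = y.
Proof. by apply: cvg_unique; exact: norm_hausdorff. Qed.

Lemma rcvg_lip (f : B -> B) (k : R) u x :
  (forall y z, rnorm (f y - f z) <= k * rnorm (y - z)) ->
  u @ \oo --> x -> (fun n => f (u n)) @ \oo --> f x.
Proof.
move=> lip /rcvgP ux; apply/rcvgP => e e0.
have k0 : 0 < `|k| + 1 by rewrite ltr_wpDl.
have : 0 < e / (`|k| + 1) by rewrite divr_gt0.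
move=> /ux; apply: filterS => n; rewrite ltr_pdivlMr //; apply: le_lt_trans.
apply: (le_trans (lip _ _)); rewrite mulrC ler_wpM2l ?rnorm_ge0 //.
by rewrite (le_trans (ler_norm k)) // lerDl.
Qed.

Lemma rcvg_cstar u x : u @ \oo --> x -> (fun n => (u n)^*) @ \oo --> x^*.
Proof.
by apply: (@rcvg_lip cstar 1) => y z; rewrite -cstarB rnorm_cstar mul1r.
Qed.

Lemma rcvg_mull a u x : u @ \oo --> x -> (fun n => a ** u n) @ \oo --> a ** x.
Proof.
apply: (@rcvg_lip (cmul a) (rnorm a)) => y z.
by rewrite -cmulNr -cmulDr rnormM.
Qed.

Lemma rcvg_mulr a u x : u @ \oo --> x -> (fun n => u n ** a) @ \oo --> x ** a.
Proof.
apply: (@rcvg_lip (fun y => y ** a) (rnorm a)) => y z.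
by rewrite -cmulNl -cmulDl mulrC rnormM.
Qed.

Lemma rcvgD u v x y : u @ \oo --> x -> v @ \oo --> y ->
  (fun n => u n + v n) @ \oo --> x + y.
Proof. exact: cvgD. Qed.

Lemma rcvgZ k u x : u @ \oo --> x -> (fun n => k *: u n) @ \oo --> k *: x.
Proof. exact: cvgZr. Qed.

Lemma rcvgM u v x y : u @ \oo --> x -> v @ \oo --> y ->
  (fun n => u n ** v n) @ \oo --> x ** y.
Proof.
move=> /rcvgP ux vy; apply/rcvgP => e e0.
have /rcvgP vyl := @rcvg_mull x _ _ vy.
have : 0 < e / 2 / (rnorm y + 1).
  by rewrite !divr_gt0 // ltr_wpDl ?rnorm_ge0.
move=> /ux ux'; move/rcvgP: vy => vy.
near=> n.
have -> : x ** y - u n ** v n = x ** y - x ** v n + (x - u n) ** v n.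
  by ncring.
apply: (le_lt_trans (rnormD _ _)).
have := rnormM (x - u n) (v n).
have h1 : rnorm (x ** y - x ** v n) < e / 2.
  by near: n; apply: vyl; rewrite divr_gt0.
have h2 : rnorm (x - u n) < e / 2 / (rnorm y + 1) by near: n.
have h3 : rnorm (y - v n) < 1 by near: n; exact: vy.
have h4 : rnorm (v n) <= rnorm y + 1.
  have -> : v n = y - (y - v n) by rewrite subKr.
  by apply: (le_trans (rnormB _ _)); rewrite lerD2l ltW.
have h5 : rnorm (x - u n) * rnorm (v n) <= e / 2.
  apply: (@le_trans _ _ (e / 2 / (rnorm y + 1) * (rnorm y + 1))).
    by apply: ler_pM => //; rewrite ?rnorm_ge0 // ltW.
  by rewrite divfK // gt_eqF // ltr_wpDl ?rnorm_ge0.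
lra.
Unshelve. all: by end_near. Qed.

Lemma rcvg_le (u : nat -> B) x (k : R) :
  u @ \oo --> x -> (forall n, rnorm (u n) <= k) -> rnorm x <= k.
Proof.
move=> /rcvgP ux uk; apply/ler_addgt0Pr => e /ux.
move=> [N _ /(_ N (leqnn N)) /= xN].
have -> : x = (x - u N) + u N by rewrite subrK.
apply: (le_trans (rnormD _ _)); rewrite addrC lerD // ltW //.
Qed.

Lemma rcvg_scale (t : nat -> R) (s : R) (u : nat -> B) x :
  t @ \oo --> s -> u @ \oo --> x ->
  (fun n => (t n)%:C *: u n) @ \oo --> s%:C *: x.
Proof.
move=> ts ux; apply: cvgZ => //.
apply/cvgrPdist_lt => e e0.
have [k ek] : exists k, e = k%:C.
  by exists (complex.Re e); rewrite RRe_real // gtr0_real.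
move: e0; rewrite ek ltcR => k0.
move/cvgrPdist_lt : ts => /(_ _ k0); apply: filterS => n /=.
by rewrite -rmorphB /= normc_def /= expr0n addr0 sqrtr_sqr ltcR.
Qed.

(** Increments of [u] are bounded by those of a bounded monotone sequence, so
    [u] is a Cauchy sequence. *)
Lemma majorized_cvg u (r : nat -> R) (M : R) :
  (forall n, rnorm (u n.+1 - u n) <= r n.+1 - r n) -> (forall n, r n <= M) ->
  exists x, u @ \oo --> x.
Proof.
move=> ur rM.
have rincr : {homo r : m n / (m <= n)%N >-> m <= n}.
  apply: homo_leq => // [x y z|n]; first exact: le_trans.
  by rewrite -subr_ge0 (le_trans (rnorm_ge0 _) (ur n)).
have dist m n : (m <= n)%N -> rnorm (u n - u m) <= r n - r m.
  move=> /subnK <-; elim: (n - m)%N => [|k IH].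
    by rewrite add0n !subrr rnorm0.
  rewrite addSn -(subrKA (u (k + m)%N)) -(subrKA (r (k + m)%N)).
  by apply: (le_trans (rnormD _ _)); rewrite lerD // ur.
have rc : cvgn r.
  by apply: nondecreasing_is_cvgn => //; exists M => _ [n _ <-].
suff : cvg (u @ \oo) by move=> uc; exists (lim (u @ \oo)).
apply: cauchy_cvg; apply/cauchy_ballP => e e0.
have [k ek] : exists k, e = k%:C.
  by exists (complex.Re e); rewrite RRe_real // gtr0_real.
move: e0; rewrite ek ltcR => k0.
have /cvgrPdist_lt /(_ _ k0) [N _ HN] := rc.
pose tail := [set u n | n in [set n | (N <= n)%N]]; exists (tail, tail).
  by split; exists N => // n Nn; exists n.
move=> [_ _] /= [[m Nm <-] [n Nn <-]].
rewrite -ball_normE /= rnormE ltcR.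
wlog mn : m n Nm Nn / (m <= n)%N.
  move=> H; have /orP[mn|nm] := leq_total m n; first exact: H.
  by rewrite rnorm_distC; exact: H.
rewrite rnorm_distC (le_lt_trans (dist _ _ mn)) //.
have rl := nondecreasing_cvgn_le rincr rc n.
have := HN m Nm; rewrite /= ger0_norm; last first.
  by rewrite subr_ge0 (nondecreasing_cvgn_le rincr rc m).
by move: rl; lra.
Qed.

Lemma rclosureP (S : set B) x :
  closure S x <-> (exists2 u, forall n, S (u n) & u @ \oo --> x).
Proof.
split=> [Sx|[u Su ux]]; last first.
  apply: (closed_cvg (closure S)) ux; first exact: closed_closure.
  by apply: nearW => n; apply: subset_closure.
have H n : {y | S y /\ rnorm (x - y) < n.+1%:R^-1}.
  apply: cid; have e0 : 0 < n.+1%:R^-1 :> R by rewrite invr_gt0.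
  have /Sx [y [Sy xy]] : nbhs x (ball x (n.+1%:R^-1 : R)%:C).
    by apply: nbhsx_ballx; rewrite ltcR.
  exists y; split=> //; move: xy; rewrite -ball_normE /= rnormE ltcR //.
exists (fun n => sval (H n)) => [n|]; first by case: (svalP (H n)).
apply/rcvgP => e e0.
have := near_infty_natSinv_lt (PosNum e0); apply: filterS => n /= ne.
by case: (svalP (H n)) => _ /lt_trans; apply.
Qed.
End Limits.

(** * Square roots *)

Section Sqrt.
Context {R : realType} {B : cstarAlgType R}.
Implicit Types (x y z a h : B).

(** With [c = 1 - d^2 - a], the solution of [(1 - s)^2 = 1 - c] is the limit of
    [s_0 = 0], [s_(n+1) = (c + s_n^2) / 2].  In the unitization
    [s_n = sqrt_scal n - sqrt_iter n].  As [|c| <= 1], the increments are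
    bounded by those of the same iteration started with the number 1 in place
    of [c], which is [sqrt_maj]. *)
Section Iteration.
Variables (d : R) (a : B).
Hypotheses (d0 : 0 <= d) (d1 : d <= 1).
Hypothesis ca : forall z, rnorm ((1 - d ^+ 2)%:C *: z - a ** z) <= rnorm z.

Fixpoint sqrt_maj n : R :=
  if n is n'.+1 then (1 + sqrt_maj n' ^+ 2) / 2 else 0.
Fixpoint sqrt_scal n : R :=
  if n is n'.+1 then (1 - d ^+ 2 + sqrt_scal n' ^+ 2) / 2 else 0.
Fixpoint sqrt_iter n : B :=
  if n is n'.+1 then
    (2^-1)%:C *: (a + (2 * sqrt_scal n')%:C *: sqrt_iter n'
                  - sqrt_iter n' ** sqrt_iter n')
  else 0.

Let S n z := (sqrt_scal n)%:C *: z - sqrt_iter n ** z.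

Let SB n x y : S n (x - y) = S n x - S n y.
Proof. rewrite /S; ncring. Qed.

Let S_rec n z : S n.+1 z =
  (2^-1)%:C *: (((1 - d ^+ 2)%:C *: z - a ** z) + S n (S n z)).
Proof. rewrite /S /=; ncfield. Qed.

Lemma sqrt_maj01 n : 0 <= sqrt_maj n <= 1.
Proof.
elim: n => [|n /andP[IH1 IH2]] /=; first lra.
by apply/andP; split; nra.
Qed.

Lemma sqrt_maj_le n : sqrt_maj n <= sqrt_maj n.+1.
Proof. by have := sqr_ge0 (1 - sqrt_maj n); rewrite /=; nra. Qed.

Let S_le n z : rnorm (S n z) <= sqrt_maj n * rnorm z.
Proof.
elim: n z => [|n IH] z; first by rewrite /S scale0r cmul0l subrr rnorm0 mul0r.
rewrite S_rec rnormZ ger0_norm ?invr_ge0 //=.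
have /andP[r0 _] := sqrt_maj01 n.
have h1 := rnormD ((1 - d ^+ 2)%:C *: z - a ** z) (S n (S n z)).
have h2 := ca z; have h3 := IH (S n z).
have h4 := ler_wpM2l r0 (IH z).
lra.
Qed.

Let S_diff n z : rnorm (S n.+1 z - S n z) <=
  (sqrt_maj n.+1 - sqrt_maj n) * rnorm z.
Proof.
elim: n z => [|n IH] z.
  have -> : S 1 z - S 0 z = (2^-1)%:C *: ((1 - d ^+ 2)%:C *: z - a ** z).
    rewrite S_rec /S /=; ncfield.
  rewrite rnormZ ger0_norm ?invr_ge0 //= expr0n addr0 subr0 mul1r.
  by rewrite ler_wpM2l ?invr_ge0.
have -> : S n.+2 z - S n.+1 z = (2^-1)%:C *:
    (S n.+1 (S n.+1 z - S n z) + (S n.+1 (S n z) - S n (S n z))).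
  rewrite (S_rec n.+1 z) [in X in _ - X = _](S_rec n z).
  rewrite (SB n.+1 (S n.+1 z) (S n z)); ncfield.
rewrite rnormZ ger0_norm ?invr_ge0 //.
have /andP[r0 _] := sqrt_maj01 n; have /andP[r1 _] := sqrt_maj01 n.+1.
have h1 := rnormD (S n.+1 (S n.+1 z - S n z)) (S n.+1 (S n z) - S n (S n z)).
have h2 := S_le n.+1 (S n.+1 z - S n z).
have h3 := ler_wpM2l r1 (IH z).
have h4 := IH (S n z).
have dr : 0 <= sqrt_maj n.+1 - sqrt_maj n by rewrite subr_ge0 sqrt_maj_le.
have h5 := ler_wpM2l dr (S_le n z).
have -> : sqrt_maj n.+2 = (1 + sqrt_maj n.+1 ^+ 2) / 2 by [].
have E : sqrt_maj n.+1 = (1 + sqrt_maj n ^+ 2) / 2 by [].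
set r := sqrt_maj n in E h1 h2 h3 h4 h5 dr r0 *.
set r' := sqrt_maj n.+1 in E h1 h2 h3 h4 h5 dr r1 *.
suff : (1 + r' ^+ 2) / 2 - r' = 2^-1 * (r' ^+ 2 - r ^+ 2).
  move=> ->; nra.
rewrite {2}E; lra.
Qed.

Lemma sqrt_scal_bounds n :
  [/\ 0 <= sqrt_scal n, sqrt_scal n <= 1 - d & sqrt_scal n <= sqrt_scal n.+1].
Proof.
have d2 : d ^+ 2 <= 1 by rewrite expr_le1.
elim: n => [|n [IH1 IH2 _]].
  by split=> /=; rewrite ?(expr2 0) ?mulr0 ?addr0 ?divr_ge0 ?subr_ge0.
have h : sqrt_scal n.+1 <= 1 - d.
  by rewrite /= ler_pdivrMr //; have := ler_pM IH1 IH1 IH2 IH2; lra.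
have h0 : 0 <= sqrt_scal n.+1 
  by rewrite /= divr_ge0 // addr_ge0 ?sqr_ge0 // subr_ge0.
split=> //.
have -> : sqrt_scal n.+2 = (1 - d ^+ 2 + sqrt_scal n.+1 ^+ 2) / 2 by [].
move: h h0; set t := sqrt_scal n.+1 => h h0.
have h1 : 0 <= 1 - d - t by rewrite subr_ge0.
have h2 : 0 <= 1 - t + d by rewrite addr_ge0 // subr_ge0 (le_trans h) // gerBl.
have := mulr_ge0 h1 h2; lra.
Qed.

(** The limit [l] satisfies [(1 - l)^2 = d^2], and [l <= 1 - d]. *)
Lemma sqrt_scal_cvg : sqrt_scal @ \oo --> 1 - d.
Proof.
have scv : cvgn sqrt_scal.
  apply: nondecreasing_is_cvgn.
    by apply: homo_leq => // [x y z|n]; [exact: le_trans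
      | case: (sqrt_scal_bounds n)].
  by exists (1 - d) => _ [n _ <-]; case: (sqrt_scal_bounds n).
set l := limn sqrt_scal in scv.
have l1 : l <= 1 - d.
  by apply: limr_le => //; apply: nearW => n; case: (sqrt_scal_bounds n).
have El : l = (1 - d ^+ 2 + l ^+ 2) / 2.
  have sc1 : (fun n => sqrt_scal n.+1) @ \oo --> l.
    by rewrite -cvg_shiftS in scv.
  apply: (cvg_unique _ sc1) => //.
  apply: cvgMl; apply: cvgD; first exact: cvg_cst.
  by rewrite expr2; under eq_fun do rewrite expr2; exact: cvgM.
suff <- : l = 1 - d by [].
have : (1 - d - l) * (1 - l + d) = 0 by move: El; lra.
move=> /eqP; rewrite mulf_eq0 => /orP[/eqP|/eqP]; first lra.
by move: d0 => d0' ?; lra.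
Qed.

(** [sqrt_iter n] is the difference between the scalar [sqrt_scal n] and [s_n],
    and the increments of both are majorised. *)
Let h_diff n : rnorm (sqrt_iter n.+1 - sqrt_iter n) <=
  2 * sqrt_maj n.+1 - 2 * sqrt_maj n.
Proof.
have dr : 0 <= sqrt_maj n.+1 - sqrt_maj n by rewrite subr_ge0 sqrt_maj_le.
have scal_diff : `|sqrt_scal n.+1 - sqrt_scal n| <= sqrt_maj n.+1 - sqrt_maj n.
  have [_ _] := sqrt_scal_bounds n; rewrite -subr_ge0 => /ger0_norm ->.
  elim: {dr} n => [|n IH].
    by rewrite /= expr0n !addr0 !subr0 ler_pM2r // gerBl sqr_ge0.
  have [a1 a2 a3] := sqrt_scal_bounds n.
  have sm m : sqrt_scal m <= sqrt_maj m.
    elim: m => [|m IHm] //=; rewrite ler_pM2r // lerD // ?gerBl ?sqr_ge0 //.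
    by rewrite !expr2 ler_pM //; case: (sqrt_scal_bounds m).
  have b1 := sm n; have b2 := sm n.+1.
  have -> : sqrt_maj n.+2 = (1 + sqrt_maj n.+1 ^+ 2) / 2 by [].
  have -> : sqrt_scal n.+2 = (1 - d ^+ 2 + sqrt_scal n.+1 ^+ 2) / 2 by [].
  have E : sqrt_maj n.+1 = (1 + sqrt_maj n ^+ 2) / 2 by [].
  have E' : sqrt_scal n.+1 = (1 - d ^+ 2 + sqrt_scal n ^+ 2) / 2 by [].
  rewrite [in X in _ <= _ - X]E [in X in _ - X <= _]E'.
  have c1 : 0 <= sqrt_scal n.+1 - sqrt_scal n by rewrite subr_ge0.
  have c2 : 0 <= sqrt_scal n.+1 + sqrt_scal n.
    by rewrite addr_ge0 // (le_trans a1 a3).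
  have := ler_pM c1 c2 IH (lerD b2 b1); lra.
apply: rnorm_le_mul => [|z]; first lra.
have -> : (sqrt_iter n.+1 - sqrt_iter n) ** z =
    (sqrt_scal n.+1 - sqrt_scal n)%:C *: z - (S n.+1 z - S n z).
  by rewrite /S; ncring.
have h1 := rnormB ((sqrt_scal n.+1 - sqrt_scal n)%:C *: z) (S n.+1 z - S n z).
move: h1; rewrite rnormZ => h1.
have h2 := S_diff n z; have h3 := ler_wpM2r (rnorm_ge0 z) scal_diff.
lra.
Qed.

Lemma sqrt_iter_limit : exists h,
  [/\ sqrt_iter @ \oo --> h, h ** h + (2 * d)%:C *: h = a &
      forall z, rnorm ((1 - d)%:C *: z - h ** z) <= rnorm z].
Proof.
have [h hc] : exists h, sqrt_iter @ \oo --> h.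
  apply: (majorized_cvg h_diff (M := 2)) => n.
  by have /andP[_ r1] := sqrt_maj01 n; rewrite -{2}(mulr1 2) ler_pM2l.
exists h; split=> // [|z].
  have hc1 : (fun n => sqrt_iter n.+1) @ \oo --> h by rewrite -cvg_shiftS in hc.
  have E : h = (2^-1)%:C *: (a + (2 * (1 - d))%:C *: h - h ** h).
    apply: rcvg_uniq hc1 _; apply: rcvgZ; apply: rcvgD; last first.
      by apply: cvgN; exact: rcvgM.
    apply: rcvgD; first exact: cvg_cst.
    apply: rcvg_scale => //.
    by apply: cvgM; [exact: cvg_cst | exact: sqrt_scal_cvg].
  have E2 : 2%:C *: h = a + (2 * (1 - d))%:C *: h - h ** h.
    by rewrite {1}E; ncfield.
  apply/eqP; rewrite -subr_eq0; apply/eqP.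
  transitivity (2%:C *: h - (a + (2 * (1 - d))%:C *: h - h ** h)); first ncring.
  by rewrite {1}E2 subrr.
apply: (@rcvg_le _ _ (fun n => S n z)) => [|n].
  apply: rcvgD; last first.
    by apply: cvgN; exact: rcvg_mulr.
  by apply: rcvg_scale; [exact: sqrt_scal_cvg | exact: cvg_cst].
apply: (le_trans (S_le n z)); rewrite ler_piMl ?rnorm_ge0 //.
by case/andP: (sqrt_maj01 n).
Qed.
End Iteration.

(** In the unitization the equation reads [(d + h)^2 = d^2 + a], and the last
    clause says that [1 - (d + h)] is a contraction.  The scalar [d] matters in
    two cases: [d = 1] gives the square root of [1 + a] for a contraction [a],
    and [d = 0] gives a square root of [a] inside the algebra.  The commutation
    clause holds since the approximants are polynomials in [a]. *)
Lemma exists_sqrt (A : set B) (d : R) a :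
  cstar_subalgebra A -> A a -> a^* = a -> 0 <= d <= 1 ->
  (forall z, rnorm ((1 - d ^+ 2)%:C *: z - a ** z) <= rnorm z) ->
  exists h, [/\ A h, h^* = h, (forall w, w ** a = a ** w -> w ** h = h ** w),
    h ** h + (2 * d)%:C *: h = a &
    forall z, rnorm ((1 - d)%:C *: z - h ** z) <= rnorm z].
Proof.
move=> [A0 AD AZ AM [_ Acl]] Aa as_ /andP[d0 d1] ca.
have [h [hc hE hle]] := sqrt_iter_limit d0 d1 ca.
have AB x y : A x -> A y -> A (x - y).
  by move=> Ax Ay; apply: AD => //; rewrite -scaleN1r; exact: AZ.
exists h; split=> // [||w wa].
- apply: (closed_cvg A Acl _ _ hc); apply: nearW; elim=> [|n IH] //=.
  by apply: (AZ _ _); apply: AB; [apply: AD => //; exact: AZ | exact: AM].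
- have E n : (sqrt_iter d a n)^* = sqrt_iter d a n.
    elim: n => [|n IH] /=; first exact: cstar0.
    by rewrite cstarZR cstarB cstarD cstarZR cstarM IH as_.
  have := rcvg_cstar hc; under eq_fun do rewrite E.
  by move=> hc'; exact: rcvg_uniq hc' hc.
- have E n : w ** sqrt_iter d a n = sqrt_iter d a n ** w.
    elim: n => [|n IH] /=; first by rewrite cmul0l cmul0r.
    rewrite !(cmulZr, cmulZl, cmulDr, cmulDl, cmulNr, cmulNl) wa IH.
    by rewrite cmulA IH -!cmulA IH.
  have := @rcvg_mull _ _ w _ _ hc; under eq_fun do rewrite E.
  by move=> hc'; apply: rcvg_uniq hc' _; exact: rcvg_mulr.
Qed.
End Sqrt.

(** * Self-adjoint contractions and positivity *)

Section Positivity.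
Context {R : realType} {B : cstarAlgType R}.
Implicit Types (x y z u h : B).

Lemma rnorm_contraction x z : rnorm x <= 1 -> rnorm (x ** z) <= rnorm z.
Proof.
by move=> x1; rewrite (le_trans (rnormM _ _)) // ler_piMl ?rnorm_ge0.
Qed.

Lemma conjc_imag : conjc ('i%C : R[i]) = - 'i%C.
Proof. by apply/eqP; rewrite eq_complex /= oppr0 !eqxx. Qed.

Lemma subalgebra_setT : cstar_subalgebra [set: B].
Proof. by split=> //; split=> //; exact: closedT. Qed.

(** Let [1 + h] be the square root of [1 - u^2].  Then [V = u + i (1 + h)] is
    unitary in the unitization, that is, left multiplication by [V] or its
    adjoint is isometric.  The element [r] is the imaginary part of [V^2], and
    [2 u^2 - 1] is its real part; both are contractions. *)
Lemma double_angle (A : set B) u :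
  cstar_subalgebra A -> A u -> u^* = u -> rnorm u <= 1 ->
  (exists r, [/\ A r, r^* = r, r ** r = 4%:C *: (u ** u) -
       4%:C *: (u ** u ** (u ** u)), rnorm r <= 1 &
       forall w, w ** u = u ** w -> w ** r = r ** w]) /\
  forall z, rnorm (z - 2%:C *: (u ** u ** z)) <= rnorm z.
Proof.
move=> sA Au us u1.
have [A0 AD AZ AM _] := sA.
have ca z : rnorm ((1 - 1 ^+ 2)%:C *: z - (- (u ** u)) ** z) <= rnorm z.
  have -> : (1 - 1 ^+ 2)%:C *: z - (- (u ** u)) ** z = u ** (u ** z) by ncring.
  exact: (le_trans (rnorm_contraction _ _) (rnorm_contraction _ _)).
have Auu : A (- (u ** u)) by rewrite -scaleN1r; exact/AZ/AM.
have uus : (- (u ** u))^* = - (u ** u) by rewrite cstarN cstarM us.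
have h01 : 0 <= (1 : R) <= 1 by rewrite ler01 lexx.
have [h [Ah hs hcomm hE _]] := exists_sqrt sA Auu uus h01 ca.
have huu w : w ** u = u ** w -> w ** h = h ** w.
  by move=> wu; apply: hcomm; rewrite cmulNl cmulNr cmulA wu -cmulA wu cmulA.
have uh : u ** h = h ** u by apply: huu.
have hE0 : h ** h + 2%:C *: h + u ** u = 0 by rewrite -(mulr1 2) hE addNr.
pose V (j : R[i]) z := u ** z + j *: (z + h ** z).
have Viso (j : R[i]) z : conjc j = - j -> j * j = -1 -> rnorm (V j z) = rnorm z.
  move=> jc jj.
  suff : rnorm (V j z) ^+ 2 = rnorm z ^+ 2.
    by move=> /eqP; rewrite eqrXn2 ?rnorm_ge0 // => /eqP.
  rewrite -!rnorm_cstarM /V cstarD cstarM us cstarZ jc cstarD cstarM hs.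
  (* the difference lies in the ideal generated by the relations satisfied
     by [h]: the equation of the square root and the commutation with [u] *)
  congr rnorm; apply/eqP; rewrite -subr_eq0; apply/eqP.
  transitivity (z^* ** ((h ** h + 2%:C *: h + u ** u) ** z)
     + j *: (z^* ** ((u ** h - h ** u) ** z))); first by ncring: jj.
  by rewrite hE0 uh subrr cmul0l cmul0r scaler0 addr0.
have ii : ('i%C : R[i]) * 'i%C = -1 by rewrite -expr2 sqr_i.
have nc : conjc (- 'i%C : R[i]) = - (- 'i%C) 
  by apply/eqP; rewrite eq_complex /= !oppr0 !eqxx.
have nn : (- 'i%C : R[i]) * (- 'i%C) = -1 by rewrite mulrNN.
have V1 z : rnorm (V 'i%C (V 'i%C z)) = rnorm z by rewrite !Viso // conjc_imag.
have V2 z : rnorm (V (- 'i%C) (V (- 'i%C) z)) = rnorm z by rewrite !Viso.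
split; last first.
  move=> z; have E : 2%:C *: (z - 2%:C *: (u ** u ** z)) =
      - V 'i%C (V 'i%C z) - V (- 'i%C) (V (- 'i%C) z)
      - 2%:C *: ((h ** h + 2%:C *: h + u ** u) ** z).
    by rewrite /V; ncring: ii.
  have : rnorm (2%:C *: (z - 2%:C *: (u ** u ** z))) <= rnorm z + rnorm z.
    rewrite E hE0 cmul0l scaler0 subr0 (le_trans (rnormB _ _)) //.
    by rewrite rnormN V1 V2.
  rewrite rnormZ ger0_norm //; lra.
exists (2%:C *: (u + u ** h)); split.
- by apply: (AZ _ _); apply: (AD _ _) => //; exact: AM.
- by rewrite cstarZR cstarD cstarM us hs uh.
- apply/eqP; rewrite -subr_eq0; apply/eqP.
  transitivity (4%:C *: (u ** (h ** u - u ** h) + u ** (h ** u - u ** h) ** h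
    + u ** u ** (h ** h + 2%:C *: h + u ** u))); first by ncring.
  by rewrite hE0 uh subrr !(cmul0l, cmul0r) !addr0 scaler0.
- apply: rnorm_le_mul => // z; rewrite mul1r.
  have E : (2%:C * 'i%C) *: ((2%:C *: (u + u ** h)) ** z) =
      V 'i%C (V 'i%C z) - V (- 'i%C) (V (- 'i%C) z)
      - (2%:C * 'i%C) *: ((h ** u - u ** h) ** z).
    by rewrite /V; ncring: ii.
  have : rnorm ((2%:C * 'i%C) *: ((2%:C *: (u + u ** h)) ** z)) <=
      rnorm z + rnorm z.
    rewrite E uh subrr cmul0l scaler0 subr0 (le_trans (rnormB _ _)) //.
    by rewrite V1 V2.
  rewrite -scalerA rnormZ (@rnorm_imag _ _ 'i%C) // ger0_norm //; lra.
- move=> w wu; rewrite cmulZr cmulZl cmulDr cmulDl wu; congr (_ *: (_ + _)).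
  by rewrite cmulA wu -!cmulA huu.
Qed.

(** The bound says [|T - u^2| <= T].  It is obtained already for [T] half of the
    norm of [u^2], because [|1 - 2 u^2| <= 1] for a contraction [u]; the factor
    one half is essential in [sqr_le_add]. *)
Lemma sqr_bound u z (T : R) : u^* = u -> rnorm u ^+ 2 <= 2 * T ->
  rnorm (T%:C *: z - u ** u ** z) <= T * rnorm z.
Proof.
move=> us uT.
have [u0|/eqP u0] := eqVneq u 0.
  rewrite u0 !cmul0l subr0 rnormZ ger0_norm //.
  by move: uT; rewrite u0 rnorm0 expr0n pmulr_rge0.
have k0 := rnorm_gt0 u0; set k := rnorm u in uT k0.
have kN : k != 0 by exact: lt0r_neq0.
pose v := (k^-1)%:C *: u.
have vs : v^* = v by rewrite /v cstarZR us.
have v1 : rnorm v <= 1.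
  by rewrite /v rnormZ gtr0_norm ?invr_gt0 // -/k mulVf.
have [_ /(_ z) vz] := double_angle subalgebra_setT (I : setT v) vs v1.
have uv : u = k%:C *: v by rewrite /v scalerA -rmorphM /= divff // scale1r.
have -> : T%:C *: z - u ** u ** z = (T - k ^+ 2 / 2)%:C *: z +
    (k ^+ 2 / 2)%:C *: (z - 2%:C *: (v ** v ** z)).
  by rewrite uv; ncfield.
have T1 : 0 <= T - k ^+ 2 / 2 by lra.
have T2 : 0 <= k ^+ 2 / 2 by rewrite divr_ge0 // sqr_ge0.
apply: (le_trans (rnormD _ _)); rewrite !rnormZ !ger0_norm //.
have := ler_wpM2l T2 vz; lra.
Qed.

(** Positivity of a self-adjoint [x] in the form [|T - x| <= T] for one [T]:
    unlike [x = u ** u] or [x = z^* ** z], it is visibly stable under sums. *)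
Definition nonneg x := x^* = x /\
  exists2 T : R, 0 < T & forall z, rnorm (T%:C *: z - x ** z) <= T * rnorm z.

Lemma nonneg_sqr u : u^* = u -> nonneg (u ** u).
Proof.
move=> us; split; first by rewrite cstarM us.
exists (rnorm u ^+ 2 + 1) => [|z]; first by rewrite ltr_wpDl ?sqr_ge0.
by apply: sqr_bound => //; have := sqr_ge0 (rnorm u); lra.
Qed.

Lemma nonnegD x y : nonneg x -> nonneg y -> nonneg (x + y).
Proof.
move=> [xs [T T0 xT]] [ys [T' T'0 yT]]; split; first by rewrite cstarD xs ys.
exists (T + T') => [|z]; first by rewrite addr_gt0.
have -> : (T + T')%:C *: z - (x + y) ** z =
  (T%:C *: z - x ** z) + (T'%:C *: z - y ** z) by ncring.
by rewrite mulrDl (le_trans (rnormD _ _)) // lerD.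
Qed.

(** The bound says that [1 - x / T] is a contraction, so [x / T] has a square
    root. *)
Lemma nonneg_sqrt x : nonneg x -> exists2 u, u^* = u & u ** u = x.
Proof.
move=> [xs [T T0 xT]].
have TN : T != 0 by rewrite gt_eqF.
have h01 : 0 <= (0 : R) <= 1 by rewrite lexx ler01.
have xs' : ((T^-1)%:C *: x)^* = (T^-1)%:C *: x by rewrite cstarZR xs.
have ca z : rnorm ((1 - 0 ^+ 2)%:C *: z - ((T^-1)%:C *: x) ** z) <= rnorm z.
  have -> : (1 - 0 ^+ 2)%:C *: z - ((T^-1)%:C *: x) ** z =
      (T^-1)%:C *: (T%:C *: z - x ** z).
    have E : (T^-1)%:C * T%:C = 1 :> R[i] by rewrite -rmorphM /= mulVf.
    by ncring: E.
  by rewrite rnormZ gtr0_norm ?invr_gt0 // ler_pdivrMl.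
have [h [_ hs _ hE _]] := exists_sqrt subalgebra_setT I xs' h01 ca.
exists ((Num.sqrt T)%:C *: h); first by rewrite cstarZR hs.
rewrite cmulZr cmulZl scalerA -rmorphM /= -expr2 sqr_sqrtr ?ltW //.
move: hE; rewrite mulr0 scale0r addr0 => ->.
by rewrite scalerA -rmorphM /= divff // scale1r.
Qed.

Lemma nonneg_bound x z (T : R) : nonneg x -> rnorm x <= 2 * T ->
  rnorm (T%:C *: z - x ** z) <= T * rnorm z.
Proof.
move=> /nonneg_sqrt [u us <-]; rewrite rnorm_sqr //; exact: sqr_bound.
Qed.

(** With [y = (p + i q) / 2], [p] and [q] self-adjoint, twice the anticommutator
    of [y] and [y^*] is [p^2 + q^2]. *)
Lemma nonneg_anticomm y : nonneg (2%:C *: (y ** y^* + y^* ** y)).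
Proof.
have ii : ('i%C : R[i]) * 'i%C = -1 by rewrite -expr2 sqr_i.
have -> : 2%:C *: (y ** y^* + y^* ** y) = (y + y^*) ** (y + y^*) +
    ('i%C *: (y - y^*)) ** ('i%C *: (y - y^*)) by ncring: ii.
apply: nonnegD; apply: nonneg_sqr; first by rewrite cstarD cstarK addrC.
rewrite cstarZ cstarB cstarK.
by rewrite conjc_imag scaleNr -scalerN opprB.
Qed.

(** This is a quantitative form of the fact that [- y^* y] can be positive only
    if [y = 0].  If [u^2 + y^* y = h] is small compared to [t = |y|^2], then
    [S = y^* y] is [- u^2] up to [h], and [Q = y y^*], which is
    [(y y^* + y^* y) - S], is positive up to [h].  In terms of norms,
    [|T + S|] and [|T - Q|] exceed [T] by at most [|h|], where [T] is about
    [3 t / 2].  On the other hand [Q (T + Q)^2 = y (T + S)^2 y^*], so that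
    [4 T Q^2 = y (T + S)^2 y^* - Q (T - Q)^2] has norm at most about
    [2 t T^2], whereas it is [4 T t^2]; this contradicts [T < 2 t]. *)
Lemma sqr_le_add u y : u^* = u ->
  rnorm (u ** u) <= 9 * rnorm (u ** u + y^* ** y).
Proof.
move=> us; set h := u ** u + y^* ** y.
pose t := rnorm y ^+ 2; pose e := rnorm h.
have e0 : 0 <= e by exact: rnorm_ge0.
have uut : rnorm (u ** u) <= t + e.
  have -> : u ** u = h - y^* ** y by rewrite /h addrK.
  by rewrite (le_trans (rnormB _ _)) // rnorm_cstarM addrC.
suff te : t <= 8 * e by rewrite -/e; lra.
rewrite leNgt; apply/negP => et.
pose T := t + (t + e) / 2.
have hz z : rnorm (h ** z) <= e * rnorm z by exact: rnormM.
have uT z (T' : R) : (t + e) / 2 <= T' ->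
    rnorm (T'%:C *: z - u ** u ** z) <= T' * rnorm z.
  by move=> TT; apply: sqr_bound => //; rewrite -rnorm_sqr //; lra.
have SE z : rnorm (T%:C *: z + y^* ** y ** z) <= (T + e) * rnorm z.
  have -> : T%:C *: z + y^* ** y ** z = (T%:C *: z - u ** u ** z) + h ** z.
    by rewrite /h; ncring.
  apply: (le_trans (rnormD _ _)); rewrite mulrDl lerD //.
  by apply: uT; rewrite /T; lra.
have WE z : rnorm (t%:C *: z - (y ** y^* + y^* ** y) ** z) <= t * rnorm z.
  have W2 : rnorm (2%:C *: (y ** y^* + y^* ** y)) <= 2 * (2 * t).
    rewrite rnormZ ger0_norm // ler_pM2l // (le_trans (rnormD _ _)) //.
    by rewrite rnorm_cstarM rnorm_mulCstar -/t; lra.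
  have := nonneg_bound z (nonneg_anticomm y) W2.
  have -> : (2 * t)%:C *: z - (2%:C *: (y ** y^* + y^* ** y)) ** z =
    2%:C *: (t%:C *: z - (y ** y^* + y^* ** y) ** z) by ncring.
  rewrite rnormZ ger0_norm //; lra.
have QE z : rnorm (T%:C *: z - y ** y^* ** z) <= (T + e) * rnorm z.
  have -> : T%:C *: z - y ** y^* ** z = (t%:C *: z - (y ** y^* + y^* ** y) ** z)
     + (((t + e) / 2)%:C *: z - u ** u ** z) + h ** z.
    by rewrite /h /T; ncring.
  have h1 := uT z _ (lexx ((t + e) / 2)).
  apply: (le_trans (rnormD _ _)); rewrite (mulrDl T) lerD //.
  apply: (le_trans (rnormD _ _)).
  by have := WE z; rewrite /T; lra.
pose a := T%:C *: y^* + y^* ** y ** y^*.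
pose b := T%:C *: (y ** y^*) - y ** y^* ** (y ** y^*).
have E : (4 * T)%:C *: (y ** y^* ** (y ** y^*)) =
    y ** (T%:C *: a + y^* ** y ** a) - (T%:C *: b - y ** y^* ** b).
  by rewrite /a /b; ncring.
have T0 : 0 < T by rewrite /T; lra.
have yy : rnorm (y ** y^*) = t by rewrite rnorm_mulCstar.
have nE : rnorm ((4 * T)%:C *: (y ** y^* ** (y ** y^*))) = 4 * T * t ^+ 2.
  rewrite rnormZ gtr0_norm ?mulr_gt0 // rnorm_sqr ?yy //.
  by rewrite cstarM cstarK.
have Te0 : 0 <= T + e by rewrite addr_ge0 // ltW.
have b1 : rnorm a <= (T + e) * rnorm y by rewrite -(rnorm_cstar y); exact: SE.
have b2 : rnorm (y ** (T%:C *: a + y^* ** y ** a)) <= (T + e) ^+ 2 * t.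
  apply: (le_trans (rnormM _ _)).
  have := ler_wpM2l (rnorm_ge0 y) (le_trans (SE a) (ler_wpM2l Te0 b1)).
  by rewrite /t; lra.
have b3 : rnorm (T%:C *: b - y ** y^* ** b) <= (T + e) ^+ 2 * t.
  apply: (le_trans (QE b)); have := ler_wpM2l Te0 (QE (y ** y^*)).
  by rewrite -/b yy; lra.
have b4 : 4 * T * t ^+ 2 <= 2 * (T + e) ^+ 2 * t.
  by rewrite -nE E (le_trans (rnormB _ _)) //; lra.
have t0 : 0 < t by lra.
have b5 : 4 * T * t <= 2 * (T + e) ^+ 2 by rewrite -(ler_pM2r t0); lra.
have b6 : 3 / 2 * t <= T by rewrite /T; lra.
have b7 : T + e <= 27 / 16 * t by rewrite /T; lra.
have b8 := ler_pM Te0 Te0 b7 b7.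
have b9 := ler_wpM2r (ltW t0) b6.
have := mulr_gt0 t0 t0; lra.
Qed.

(** Multiplying by [x] on the left and [x^*] on the right turns [x^* x] into the
    square of [x x^*]. *)
Lemma norm_le_add x y : rnorm x ^+ 2 <= 9 * rnorm (x^* ** x + y^* ** y).
Proof.
have [->|/eqP x0] := eqVneq x 0.
  by rewrite rnorm0 expr0n mulr_ge0 // rnorm_ge0.
have xx : (x ** x^*)^* = x ** x^* by rewrite cstarM cstarK.
have := sqr_le_add (y ** x^*) xx; rewrite rnorm_sqr // rnorm_mulCstar.
have -> : x ** x^* ** (x ** x^*) + (y ** x^*)^* ** (y ** x^*) =
    x ** (x^* ** x + y^* ** y) ** x^*.
  by rewrite cstarM cstarK; ncring.
move=> H; have x1 := rnorm_gt0 x0.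
have := rnormM (x ** (x^* ** x + y^* ** y)) x^*.
have := ler_wpM2r (rnorm_ge0 x^*) (rnormM x (x^* ** x + y^* ** y)).
rewrite rnorm_cstar => h1 h2.
have x2 : 0 < rnorm x ^+ 2 by rewrite exprn_gt0.
rewrite -(ler_pM2r x2); lra.
Qed.
End Positivity.

(** * Resolvents *)

Section Resolvent.
Context {R : realType} {B : cstarAlgType R}.
Implicit Types (x y z a d e f p : B).

(** If [|g - a| < 1] in the unitization, then [f = k a / (1 - g + a)] exists in
    [B]: it is the fixed point of a contraction, the sum of a geometric
    series. *)
Lemma resolvent a (g k q : R) : a^* = a -> 0 <= q < 1 ->
  (forall z, rnorm (g%:C *: z - a ** z) <= q * rnorm z) ->
  exists f, [/\ f^* = f, forall w, w ** a = a ** w -> w ** f = f ** w &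
    f = k%:C *: a + (g%:C *: f - a ** f)].
Proof.
move=> as_ /andP[q0 q1] aq.
pose F f := k%:C *: a + (g%:C *: f - a ** f).
pose u n := iter n F 0.
(* the partial sums of the majorising geometric series *)
pose r n := rnorm (k%:C *: a) * (1 - q ^+ n) / (1 - q).
have q10 : 0 < 1 - q by lra.
have ur n : rnorm (u n.+1 - u n) <= r n.+1 - r n.
  have -> : r n.+1 - r n = rnorm (k%:C *: a) * q ^+ n.
    by rewrite /r exprS; field; rewrite lt0r_neq0.
  elim: n => [|n IH].
    rewrite /u /= /F scaler0 cmul0r oppr0 !addr0 expr0 mulr1 //.
  have -> : u n.+2 - u n.+1 = g%:C *: (u n.+1 - u n) - a ** (u n.+1 - u n).
    rewrite /u /= -/(u n); move: (u n) => v; rewrite /F; ncring.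
  by rewrite (le_trans (aq _)) // exprS mulrCA ler_wpM2l.
have [f fc] : exists f, u @ \oo --> f.
  apply: (majorized_cvg ur (M := rnorm (k%:C *: a) / (1 - q))) => n.
  rewrite /r ler_wpM2r ?invr_ge0 ?(ltW q10) // ler_piMr ?rnorm_ge0 //.
  by rewrite gerBl exprn_ge0.
have uw w : w ** a = a ** w -> forall n, w ** u n = u n ** w.
  move=> wa; elim=> [|n IH]; first by rewrite /u /= cmul0l cmul0r.
  have -> : u n.+1 = F (u n) by [].
  rewrite /F !(cmulDl, cmulDr, cmulZl, cmulZr, cmulNl, cmulNr) wa IH.
  by rewrite cmulA wa -!cmulA IH.
exists f; split.
- have E n : (u n)^* = u n.
    elim: n => [|n IH]; first exact: cstar0.
    have -> : u n.+1 = F (u n) by [].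
    by rewrite /F !(cstarD, cstarZR, cstarN, cstarM) IH as_ -uw.
  have := rcvg_cstar fc; under eq_fun do rewrite E.
  by move=> fc'; exact: rcvg_uniq fc' fc.
- move=> w wa; have := @rcvg_mull _ _ w _ _ fc.
  under eq_fun do rewrite (uw w wa).
  by move=> fc'; apply: rcvg_uniq fc' _; exact: rcvg_mulr.
- have fc1 : (fun n => u n.+1) @ \oo --> f by rewrite -cvg_shiftS in fc.
  apply: rcvg_uniq fc1 _; apply: rcvgD; first exact: cvg_cst.
  apply: rcvgD; first exact: rcvgZ.
  by apply: cvgN; exact: rcvg_mull.
Qed.

(** The Neumann series of [d = p - (p - d)] in the algebra [p B p], whose unit
    is [p]. *)
Lemma corner_inverse p d : is_projection p -> p ** d = d -> d^* = d ->
  rnorm (p - d) < 1 ->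
  exists g, [/\ p ** g = g, g ** p = g, g^* = g & d ** g = p].
Proof.
move=> [pp ps] pd ds pd1.
have dp : d ** p = d by rewrite -[RHS]ds -[in RHS]pd cstarM ds ps.
have bound z : rnorm (0%:C *: z - (d - p) ** z) <= rnorm (p - d) * rnorm z.
  have -> : 0%:C *: z - (d - p) ** z = (p - d) ** z by ncring.
  exact: rnormM.
have dps : (d - p)^* = d - p by rewrite cstarB ds ps.
have q01 : 0 <= rnorm (p - d) < 1 by rewrite rnorm_ge0.
have [f [fs fcomm fE]] := resolvent (-1) dps q01 bound.
rewrite scale0r add0r in fE.
have pf : p ** f = f.
  by rewrite fE !(cmulDr, cmulNr, cmulZr, cmulDl, cmulNl) !cmulA pp pd.
have fp : f ** p = f.
  by rewrite -fcomm // cmulDr cmulDl cmulNr cmulNl pd dp.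
exists (p + f); split.
- by rewrite cmulDr pp pf.
- by rewrite cmulDl pp fp.
- by rewrite cstarD fs ps.
- rewrite cmulDr dp; apply/eqP; rewrite -subr_eq0; apply/eqP.
  transitivity ((p ** f - f) + (f - ((-1)%:C *: (d - p) - (d - p) ** f))).
    by ncring.
  by rewrite -fE pf !subrr addr0.
Qed.

(** Here [f = a^2 / (e + a^2)], so that [1 - f = e / (e + a^2)] is a contraction
    and [(1 - f)^2 a^2 = e (1 - f) f]. *)
Lemma approximate_unit a (e : R) : a^* = a -> 0 < e ->
  exists f, [/\ f^* = f, f ** a = a ** f,
    e%:C *: f = a ** a - a ** a ** f,
    (forall z, rnorm (z - f ** z) <= rnorm z) &
    rnorm (a - a ** f) ^+ 2 <= 2 * e].
Proof.
move=> as_ e0.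
pose t := rnorm a ^+ 2; pose T := e + t.
have t0 : 0 <= t by rewrite sqr_ge0.
have T0 : 0 < T by rewrite /T; lra.
have TN : T != 0 by exact: lt0r_neq0.
have sb z : rnorm (t%:C *: z - a ** a ** z) <= t * rnorm z.
  by apply: sqr_bound => //; rewrite -/t; lra.
pose s := (T^-1)%:C *: (a ** a).
have ss : s^* = s by rewrite /s cstarZR cstarM as_.
have q01 : 0 <= t / T < 1.
  by rewrite divr_ge0 ?(ltW T0) //= ltr_pdivrMr // mul1r /T; lra.
have cb z : rnorm ((t / T)%:C *: z - s ** z) <= t / T * rnorm z.
  have -> : (t / T)%:C *: z - s ** z = (T^-1)%:C *: (t%:C *: z - a ** a ** z).
    by rewrite /s; ncring.
  rewrite rnormZ gtr0_norm ?invr_gt0 // [t / T]mulrC -mulrA.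
  by rewrite ler_pM2l ?invr_gt0.
have [f [fs fcomm fE]] := resolvent 1 ss q01 cb.
have fa : f ** a = a ** f.
  by rewrite fcomm // /s cmulZr cmulZl cmulA.
have ef : e%:C *: f = a ** a - a ** a ** f.
  have E : T%:C * (T^-1)%:C = 1 :> R[i] by rewrite -rmorphM /= divff.
  have E2 : T%:C *: f = a ** a + (t%:C *: f - a ** a ** f).
    by rewrite {1}fE /s; ncring: E.
  apply/eqP; rewrite -subr_eq0; apply/eqP.
  transitivity (T%:C *: f - (a ** a + (t%:C *: f - a ** a ** f))).
    by rewrite /T; ncring.
  by rewrite E2 subrr.
have fb z : rnorm (z - f ** z) <= rnorm z.
  have E : e%:C *: z = (e + t)%:C *: (z - f ** z)
      - (t%:C *: (z - f ** z) - a ** a ** (z - f ** z)).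
    apply/eqP; rewrite -subr_eq0; apply/eqP.
    transitivity ((e%:C *: f - (a ** a - a ** a ** f)) ** z); first by ncring.
    by rewrite ef subrr cmul0l.
  have h1 : e * rnorm z = rnorm (e%:C *: z) by rewrite rnormZ gtr0_norm.
  have h2 : (e + t) * rnorm (z - f ** z) = rnorm ((e + t)%:C *: (z - f ** z)).
    by rewrite rnormZ gtr0_norm.
  have h3 := rnormB (e%:C *: z)
    (- (t%:C *: (z - f ** z) - a ** a ** (z - f ** z))).
  have h4 : e%:C *: z - (- (t%:C *: (z - f ** z) - a ** a ** (z - f ** z)))
      = (e + t)%:C *: (z - f ** z) by rewrite E opprK subrK.
  rewrite h4 rnormN -h1 -h2 in h3.
  have h5 := sb (z - f ** z).
  have h6 : e * rnorm (z - f ** z) <= e * rnorm z by lra.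
  by rewrite ler_pM2l in h6.
exists f; split=> //.
have f2 : rnorm f <= 2.
  apply: rnorm_le_mul => // z.
  have -> : f ** z = z - (z - f ** z) by rewrite subKr.
  by have := rnormB z (z - f ** z); have := fb z; lra.
rewrite -rnorm_mulCstar cstarB cstarM as_ fs.
have -> : (a - a ** f) ** (a - f ** a) = e%:C *: (f - f ** f).
  have -> : (a - a ** f) ** (a - f ** a) =
      (a ** a - a ** a ** f) - (a ** a - a ** a ** f) ** f.
    (* the two sides differ by terms in the commutator of [f] and [a] *)
    apply/eqP; rewrite -subr_eq0; apply/eqP; pose D := f ** a - a ** f.
    transitivity (a ** (f ** D + D ** f - 2%:C *: D)).
      by rewrite /D; ncring.
    by rewrite /D fa subrr !(cmul0l, cmul0r) scaler0 !subr0 addr0 cmul0r.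
  by rewrite -ef; ncring.
rewrite rnormZ gtr0_norm // mulrC ler_pM2r //.
by rewrite (le_trans (fb f)).
Qed.
End Resolvent.

(** * The hereditary subalgebra generated by a self-adjoint element *)

Section Hereditary.
Context {R : realType} {B : cstarAlgType R}.
Implicit Types (x y z a b d e f p : B).

Definition corner a : set B := closure [set a ** b ** a | b in [set: B]].

Lemma corner_subalgebra a : a^* = a -> cstar_subalgebra (corner a).
Proof.
move=> as_; split.
- by apply: subset_closure; exists 0; rewrite // cmul0r cmul0l.
- move=> x y /rclosureP[u Hu ux] /rclosureP[v Hv vy]; apply/rclosureP.
  exists (fun n => u n + v n); last exact: rcvgD.
  move=> n; have [b _ <-] := Hu n; have [c _ <-] := Hv n.
  by exists (b + c); rewrite // cmulDr cmulDl.
- move=> k x /rclosureP[u Hu ux]; apply/rclosureP.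
  exists (fun n => k *: u n); last exact: rcvgZ.
  move=> n; have [b _ <-] := Hu n.
  by exists (k *: b); rewrite // cmulZr cmulZl.
- move=> x y /rclosureP[u Hu ux] /rclosureP[v Hv vy]; apply/rclosureP.
  exists (fun n => u n ** v n); last exact: rcvgM.
  move=> n; have [b _ <-] := Hu n; have [c _ <-] := Hv n.
  by exists (b ** a ** a ** c); rewrite // !cmulA.
- split; last exact: closed_closure.
  move=> x /rclosureP[u Hu ux]; apply/rclosureP.
  exists (fun n => (u n)^*); last exact: rcvg_cstar.
  move=> n; have [b _ <-] := Hu n.
  by exists (b^*); rewrite // !cstarM as_ cmulA.
Qed.

(** If [z^* z <= k^* k] with [k] in the closure of [a B a], then [z] lies in the
    closure of [B a], because [z (1 - f)] is controlled by [k (1 - f)] and [z f]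
    is a multiple of [a] for the approximate units [f] of [a]. *)
Lemma corner_hereditary a : a^* = a -> hereditary_subalgebra (corner a).
Proof.
move=> as_; split; first exact: corner_subalgebra.
move=> _ _ [z _ ->] [k Hk ->] [y _ yE].
have zy : z^* ** z + y^* ** y = k^* ** k by rewrite -yE addrC subrK.
suff [u Hu uz] : exists2 u : nat -> B,
    (forall n, exists w, u n = w ** a) & u @ \oo --> z.
  apply/rclosureP; exists (fun n => (u n)^* ** u n).
    move=> n; have [w ->] := Hu n.
    by exists (w^* ** w); rewrite // cstarM as_ !cmulA.
  by apply: rcvgM => //; exact: rcvg_cstar.
suff : closure [set w ** a | w in [set: B]] z.
  move=> /rclosureP[u Hu uz]; exists u => // n.
  by have [w _ <-] := Hu n; exists w.
suff H (e : R) : 0 < e -> exists w, rnorm (z - w ** a) < e.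
  have Hn (n : nat) : {w | rnorm (z - w ** a) < n.+1%:R^-1}.
    by apply: cid; apply: H; rewrite invr_gt0.
  apply/rclosureP; exists (fun n => sval (Hn n) ** a) => [n|].
    by exists (sval (Hn n)).
  apply/rcvgP => e e0.
  have := near_infty_natSinv_lt (PosNum e0); apply: filterS => n /= ne.
  exact: (lt_trans (svalP (Hn n)) ne).
move=> e0.
have [u Hu uk] := (rclosureP _ _).1 Hk.
move/rcvgP: uk => /(_ (e / 8)); rewrite divr_gt0 // => /(_ isT).
move=> [N _ /(_ N (leqnn N)) /= kN].
have [b _ bE] := Hu N; rewrite -bE in kN.
pose c := rnorm (a ** b) + 1.
have c0 : 0 < c by rewrite /c ltr_wpDl ?rnorm_ge0.
(* chosen so that the bound [2 * eps] on [|a (1 - f)|^2] is the square of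
   [e / 8 / c] *)
pose eps := (e / 8 / c) ^+ 2 / 2.
have ec0 : 0 < e / 8 / c by rewrite !divr_gt0.
have eps0 : 0 < eps by rewrite divr_gt0 // exprn_gt0.
have [f [fs fa fE fb af]] := approximate_unit as_ eps0.
have fbr x : rnorm (x - x ** f) <= rnorm x.
  by have := fb x^*; rewrite -rnorm_cstar cstarB cstarM cstarK fs rnorm_cstar.
have aff : rnorm (a - a ** f) <= e / 8 / c.
  rewrite -(@ler_pXn2r _ 2) ?nnegrE ?rnorm_ge0 ?(ltW ec0) //.
  by apply: (le_trans af); rewrite /eps mulrC divfK.
have kf : rnorm (k - k ** f) < e / 4.
  have -> : k - k ** f = (k - a ** b ** a) - (k - a ** b ** a) ** f
      + a ** b ** (a - a ** f) by ncring.
  apply: (le_lt_trans (rnormD _ _)).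
  have h1 := fbr (k - a ** b ** a).
  have h2 := rnormM (a ** b) (a - a ** f).
  have h3 : rnorm (a ** b) * rnorm (a - a ** f) <= c * (e / 8 / c).
    by apply: ler_pM; rewrite ?rnorm_ge0 // /c lerDl.
  have h4 : c * (e / 8 / c) = e / 8 by rewrite mulrC divfK // lt0r_neq0.
  lra.
have zf : rnorm (z - z ** f) ^+ 2 <= 9 * rnorm (k - k ** f) ^+ 2.
  rewrite -(rnorm_cstarM (k - k ** f)).
  have -> : (k - k ** f)^* ** (k - k ** f) = (z - z ** f)^* ** (z - z ** f)
       + (y - y ** f)^* ** (y - y ** f).
    rewrite !cstarB !cstarM fs; apply/eqP; rewrite -subr_eq0; apply/eqP.
    pose X := k^* ** k - (z^* ** z + y^* ** y).
    transitivity (X - f ** X - X ** f + f ** X ** f).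
      by rewrite /X; ncring.
    by rewrite /X zy subrr !(cmul0l, cmul0r) subrr subr0 addr0.
  exact: norm_le_add.
exists ((eps^-1)%:C *: (z ** (a - f ** a))).
have fw : f = (eps^-1)%:C *: ((a - f ** a) ** a).
  rewrite cmulDl cmulNl fa.
  have -> : a ** f ** a = a ** a ** f by rewrite -!cmulA fa.
  by rewrite -fE scalerA -rmorphM /= mulVf ?lt0r_neq0 // scale1r.
have -> : z - ((eps^-1)%:C *: (z ** (a - f ** a))) ** a = z - z ** f.
  by rewrite [in RHS]fw cmulZl cmulZr -cmulA.
have k0 := rnorm_ge0 (k - k ** f).
have : rnorm (z - z ** f) <= 3 * rnorm (k - k ** f).
  rewrite -(@ler_pXn2r _ 2) ?nnegrE ?rnorm_ge0 ?mulr_ge0 //.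
  by rewrite exprMn; lra.
lra.
Qed.
End Hereditary.

(** * Projections in hereditary subalgebras *)

Section Forward.
Context {R : realType} {B : cstarAlgType R}.
Implicit Types (x y z a b d e f p k v : B).

Lemma rnorm_projection p : is_projection p -> p <> 0 -> rnorm p = 1.
Proof.
move=> [pp ps] /rnorm_gt0 p0; have := rnorm_sqr ps; rewrite pp expr2.
by move=> /(congr1 (fun t => t / rnorm p)); rewrite mulfK ?divff ?lt0r_neq0.
Qed.

Lemma rnorm_projection_le1 p : is_projection p -> rnorm p <= 1.
Proof.
move=> pP; have [->|/eqP p0] := eqVneq p 0; first by rewrite rnorm0.
by rewrite rnorm_projection.
Qed.

(** [k b k^* <= C k k^*] for [C] greater than the norm of [b]: the difference is
    [w^* w] with [w = C^(1/2) (1 - b / C)^(1/2) k^*]. *)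
Lemma hereditary_sandwich (H : set B) k b :
  hereditary_subalgebra H -> H k -> b^* = b ->
  pos_cone setT (k ** b ** k^*) -> H (k ** b ** k^*).
Proof.
move=> [sH herH] Hk bs posq; have [_ _ HZ _ [Hs _]] := sH.
pose C := rnorm b + 1.
have C0 : 0 < C by rewrite /C ltr_wpDl ?rnorm_ge0.
pose c := (- C^-1)%:C *: b.
have cs : c^* = c by rewrite /c cstarZR bs.
have h01 : 0 <= (1 : R) <= 1 by rewrite ler01 lexx.
have cb z : rnorm ((1 - 1 ^+ 2)%:C *: z - c ** z) <= rnorm z.
  have -> : (1 - 1 ^+ 2)%:C *: z - c ** z = (C^-1)%:C *: (b ** z).
    by rewrite /c; ncring.
  rewrite rnormZ gtr0_norm ?invr_gt0 // ler_pdivrMl //.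
  rewrite (le_trans (rnormM _ _)) //.
  by rewrite ler_wpM2r ?rnorm_ge0 // /C lerDl.
have [h [_ hs _ hE _]] := exists_sqrt subalgebra_setT I cs h01 cb.
have sq : (Num.sqrt C)%:C * (Num.sqrt C)%:C = C%:C :> R[i].
  by rewrite -rmorphM /= -expr2 sqr_sqrtr ?(ltW C0).
apply: (herH _ (C%:C *: (k ** k^*))) => //.
  exists ((Num.sqrt C)%:C *: k^*); first exact/HZ/Hs.
  by rewrite cstarZR cstarK cmulZl cmulZr scalerA sq.
exists ((Num.sqrt C)%:C *: (k^* + h ** k^*)) => //.
rewrite cstarZR cmulZl cmulZr scalerA sq cstarD cstarM cstarK hs.
have CC : C%:C * (C^-1)%:C = 1 :> R[i].
  by rewrite -rmorphM /= divff // lt0r_neq0.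
apply/eqP; rewrite -subr_eq0; apply/eqP.
transitivity ((- C)%:C *: (k ** ((h ** h + (2 * 1)%:C *: h - c) ** k^*))).
  by rewrite /c; ncring: CC.
by rewrite hE subrr cmul0l cmul0r scaler0.
Qed.

(** Take [a = 2 u^2 - 1 + |2 u^2 - 1|], twice the positive part of [2 u^2 - 1].
    The absolute value is the square root of
    [1 - (4 u^2 - 4 u^4) = 1 - r^2], of the form [1 + h] with [h] in [A], so
    that [a = 2 u^2 + h] is in [A] although [A] may have no unit.  It is
    nonzero, as [|2 u^2| = 2] and [|h| <= 1].  Twice the negative part, that is
    [2 - 2 u^2 + h], annihilates [a], hence every [p] in the corner, so that
    [p - u^2 p = - h p / 2]. *)
Lemma spectral_cut (A : set B) u :
  cstar_subalgebra A -> A u -> u^* = u -> rnorm u = 1 ->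
  exists a, [/\ A a, a^* = a, a <> 0 & forall p, is_projection p ->
    corner (a ** a) p -> rnorm (p - p ** (u ** u) ** p) <= 2^-1].
Proof.
move=> sA Au us u1; have [A0 AD AZ AM _] := sA.
have [|[r [Ar rs rE r1 rcomm]] _] := double_angle sA Au us; first by rewrite u1.
have h01 : 0 <= (1 : R) <= 1 by rewrite ler01 lexx.
have rrs : (- (r ** r))^* = - (r ** r) by rewrite cstarN cstarM rs.
have Arr : A (- (r ** r)) by rewrite -scaleN1r; exact/AZ/AM.
have cb z : rnorm ((1 - 1 ^+ 2)%:C *: z - (- (r ** r)) ** z) <= rnorm z.
  have -> : (1 - 1 ^+ 2)%:C *: z - (- (r ** r)) ** z = r ** (r ** z) by ncring.
  exact: (le_trans (rnorm_contraction _ _) (rnorm_contraction _ _)).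
have [h [Ah hs hcomm hE hle]] := exists_sqrt sA Arr rrs h01 cb.
have uh : u ** h = h ** u.
  apply: hcomm; have ur := rcomm u erefl.
  by rewrite cmulNr cmulNl cmulA ur -!cmulA ur.
have h1 : rnorm h <= 1.
  apply: rnorm_le_mul => // z; have := hle z.
  have -> : (1 - 1)%:C *: z - h ** z = - (h ** z) by ncring.
  by rewrite rnormN mul1r.
exists (2%:C *: (u ** u) + h); split.
- by apply: (AD _ _) => //; apply: (AZ _ _); exact: AM.
- by rewrite cstarD cstarZR cstarM us hs.
- move=> a0; have : rnorm (2%:C *: (u ** u)) = rnorm h.
    by rewrite -[in RHS](subr0 h) -a0 opprD addrCA subrr addr0 rnormN.
  by rewrite rnormZ ger0_norm // rnorm_sqr // u1; lra.
set a := 2%:C *: (u ** u) + h => p pP pc.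
(* multiplication by [2 - 2 u^2 + h], twice the negative part of [2 u^2 - 1] *)
pose L x := 2%:C *: x + (h - 2%:C *: (u ** u)) ** x.
have La x : L (a ** x) = 0.
  transitivity ((h ** h + (2 * 1)%:C *: h + r ** r) ** x
    + 2%:C *: ((h ** u - u ** h) ** u + u ** (h ** u - u ** h)) ** x
    - (r ** r - (4%:C *: (u ** u) - 4%:C *: (u ** u ** (u ** u)))) ** x).
    by rewrite /L /a; ncring.
  rewrite hE rE uh !subrr addNr !(cmul0l, cmul0r) addr0 scaler0 cmul0l.
  by rewrite subr0 addr0.
have Lp : L p = 0.
  have /rclosureP[w Hw wp] := pc.
  have Lw n : L (w n) = 0 by have [b _ <-] := Hw n; rewrite -!cmulA La.
  have : (fun n => L (w n)) @ \oo --> L p.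
    by apply: rcvgD; [exact: rcvgZ | exact: rcvg_mull].
  under eq_fun do rewrite Lw.
  by move=> /rcvg_uniq; apply; exact: cvg_cst.
have [pp ps] := pP.
have -> : p - p ** (u ** u) ** p = (- 2^-1)%:C *: (p ** h ** p).
  apply/eqP; rewrite -subr_eq0; apply/eqP.
  transitivity ((2^-1)%:C *: (p ** L p) - (p ** p - p)).
    by rewrite /L; ncfield.
  by rewrite Lp cmul0r scaler0 pp subrr subr0.
rewrite rnormZ normrN ger0_norm ?invr_ge0 // ler_piMr ?invr_ge0 //.
have p1 := rnorm_projection_le1 pP.
apply: (le_trans (rnormM _ _)); rewrite mulr_ile1 ?rnorm_ge0 //.
by apply: (le_trans (rnormM _ _)); rewrite mulr_ile1 ?rnorm_ge0.
Qed.

(** With [g] the inverse of [v^* v] in [p B p], the projection [v g v^*] is the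
    range projection of [v]. *)
Lemma polar_projection p v : is_projection p -> p <> 0 -> v ** p = v ->
  rnorm (p - v^* ** v) < 1 ->
  exists g, [/\ g^* = g, is_projection (v ** g ** v^*) & v ** g ** v^* <> 0].
Proof.
move=> pP p0 vp pd1; have [pp ps] := pP.
set d := v^* ** v in pd1.
have ds : d^* = d by rewrite /d cstarM cstarK.
have pd : p ** d = d by rewrite /d cmulA -{1}ps -cstarM vp.
have [g [pg gp gs dg]] := corner_inverse pP pd ds pd1.
exists g; split=> //.
  split; last by rewrite !cstarM cstarK gs cmulA.
  have -> : v ** g ** v^* ** (v ** g ** v^*) = v ** g ** (d ** g) ** v^*.
    by rewrite /d !cmulA.
  by rewrite dg -(cmulA v g p) gp.
move=> q0; have d0 : d = 0.
  have -> : d = d ** g ** d by rewrite dg pd.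
  have -> : d ** g ** d = v^* ** (v ** g ** v^*) ** v by rewrite /d !cmulA.
  by rewrite q0 cmul0r cmul0l.
by move: pd1; rewrite d0 subr0 rnorm_projection // ltxx.
Qed.

(** The pinching element is taken for the error [N / 8], [N = |E x|].  Then
    [|m|^2 >= 7 N / 8], and the relative error made in replacing
    [p u^2 p] by [v^* v] is at most 1/7, less than the 1/2 that [spectral_cut]
    leaves free. *)
Lemma SP_of_inclusion (A : set B) (E : {linear B -> B}) :
  cstar_subalgebra A -> conditional_expectation A E -> faithful E ->
  pinching A E -> SP_inclusion A -> property_SP B.
Proof.
move=> sA [[EA _] _ Epos _] faithE pinchE spA H herH [k Hk /rnorm_gt0 k0].
have [A0 AD AZ AM [As _]] := sA.
pose x := k^* ** k.
have posx : pos_cone setT x by exists k.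
have x0 : x <> 0.
  move=> x0; have := rnorm_cstarM k; rewrite -/x x0 rnorm0 => /esym/eqP.
  by rewrite sqrf_eq0 gt_eqF.
have [z Az Exz] := Epos _ posx.
have N0 : 0 < rnorm (E x) by apply: rnorm_gt0 => /(faithE _ posx).
set N := rnorm (E x) in N0.
have e0 : 0 < N / 8 by rewrite divr_gt0.
have [y [Ay y1 y2]] := pinchE _ posx x0 _ e0.
move: y1 y2; rewrite !rnormE -rmorphB /= lecR ltcR -/N => y1 y2.
have [m Am mE] : exists2 m, A m & y^* ** E x ** y = m^* ** m.
  by exists (z ** y); [exact: AM | rewrite Exz cstarM !cmulA].
pose M := rnorm m ^+ 2.
have MN : 7 / 8 * N <= M by rewrite /M -rnorm_cstarM -mE; lra.
have M0 : 0 < M by lra.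
pose u := (M^-1)%:C *: (m ** m^*).
have Au : A u by apply: (AZ _ _); apply: AM => //; exact: As.
have us : u^* = u by rewrite /u cstarZR cstarM cstarK.
have u1 : rnorm u = 1.
  by rewrite /u rnormZ gtr0_norm ?invr_gt0 // rnorm_mulCstar mulVf // lt0r_neq0.
have [a [Aa as_ a0 cut]] := spectral_cut sA Au us u1.
have posa : pos_cone A (a ** a) by exists a; rewrite ?as_.
have aa0 : a ** a <> 0.
  move=> aa0; have := rnorm_sqr as_; rewrite aa0 rnorm0 => /esym/eqP.
  by rewrite sqrf_eq0 gt_eqF // rnorm_gt0.
have [p [pc pP p0]] := spA _ posa aa0.
have {cut pc} pu := cut p pP pc.
have p1 := rnorm_projection pP p0; have [pp ps] := pP.
pose v := (M^-1)%:C *: (k ** y ** m^* ** p).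
have vp : v ** p = v by rewrite /v cmulZl -!cmulA pp.
have vv : rnorm (p - v^* ** v) < 1.
  have -> : p - v^* ** v = (p - p ** (u ** u) ** p)
      - ((M^-1) ^+ 2)%:C *: (p ** (m ** (y^* ** (x - E x) ** y) ** m^*) ** p).
    have -> : p ** (u ** u) ** p =
        ((M^-1) ^+ 2)%:C *: (p ** (m ** (y^* ** E x ** y) ** m^*) ** p).
      by rewrite mE /u; ncring.
    by rewrite /v cstarZR !cstarM cstarK ps /x; ncring.
  have h1 : rnorm (p ** (m ** (y^* ** (x - E x) ** y) ** m^*) ** p) <=
      M * (N / 8).
    apply: (le_trans (rnormM _ _)); rewrite p1 mulr1.
    apply: (le_trans (rnormM _ _)); rewrite p1 mul1r.
    apply: (le_trans (rnormM _ _)); rewrite rnorm_cstar.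
    have := ler_wpM2r (rnorm_ge0 m) (rnormM m (y^* ** (x - E x) ** y)).
    have := ler_wpM2l (sqr_ge0 (rnorm m)) (ltW y1); rewrite /M; lra.
  have MV : 0 < M^-1 by rewrite invr_gt0.
  have h2 : M^-1 ^+ 2 * (M * (N / 8)) <= 7^-1.
    rewrite expr2 -mulrA mulKf ?lt0r_neq0 // ler_pdivrMl //; lra.
  apply: (le_lt_trans (rnormB _ _)).
  rewrite rnormZ (ger0_norm (sqr_ge0 _)).
  have := ler_wpM2l (sqr_ge0 M^-1) h1; lra.
have [g [gs qP q0]] := polar_projection pP p0 vp vv.
exists (v ** g ** v^*); split=> //.
pose b := ((M^-1) ^+ 2)%:C *: (y ** m^* ** p ** g ** p ** m ** y^*).
have bs : b^* = b by rewrite /b cstarZR !cstarM !cstarK gs ps !cmulA.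
have qE : v ** g ** v^* = k ** b ** k^*.
  by rewrite /v /b cstarZR !cstarM cstarK ps; ncring.
rewrite qE; apply: hereditary_sandwich => //; rewrite -qE.
by case: qP => qq qs; exists (v ** g ** v^*); rewrite // qs qq.
Qed.

(** The closure of [a B a] is nonzero because it contains [a^3]. *)
Lemma SP_inclusion_of_SP (A : set B) : property_SP B -> SP_inclusion A.
Proof.
move=> spB a [z _ aE] a0.
have as_ : a^* = a by rewrite aE cstarM cstarK.
apply: (spB (corner a)); first exact: corner_hereditary.
exists (a ** a ** a); first by apply: subset_closure; exists a.
move=> aaa; apply: a0; apply: rnorm0_eq0; apply/eqP.
have aas : (a ** a)^* = a ** a by rewrite cstarM as_.
have := rnorm_sqr aas; rewrite cmulA aaa cmul0l rnorm0 rnorm_sqr //.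
by move=> /esym/eqP; rewrite !sqrf_eq0.
Qed.
End Forward.

Theorem theoremD (R : realType) (B : cstarAlgType R) (A : set B)
    (E : {linear B -> B})
    (subA : cstar_subalgebra A)
    (condE : conditional_expectation A E)
    (faithE : faithful E)
    (pinchE : pinching A E) :
  SP_inclusion A <-> property_SP B.
Proof.
split; last exact: SP_inclusion_of_SP.
exact: SP_of_inclusion subA condE faithE pinchE.
Qed.
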